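(* Let $m\ge 2$, $\alpha_1,\dots,\alpha_m>0$, and let $\epsilon_1^{0},\dots,\epsilon_m^{0}\in\mathbb{R}^d$ be the zero-sum base noise vectors and $\epsilon_k=\alpha_k\epsilon_k^{0}$ the scaled noise vectors constructed as in the context. Let $\theta\in\mathbb{R}^d$, let $\Delta^\star:\mathbb{R}^d\to\mathbb{R}^d$ be differentiable at $\theta$ with Jacobian $J$ at $\theta$, and suppose that vectors $\widehat{\Delta}^{(1)},\dots,\widehat{\Delta}^{(m)}\in\mathbb{R}^d$ satisfy $$\widehat{\Delta}^{(k)}=\Delta^\star(\theta)+J\,\epsilon_k+\rho_k,\qquad k=1,\dots,m,$$ for some remainder vectors $\rho_1,\dots,\rho_m\in\mathbb{R}^d$. Define the harmonic weights and the aggregated update by $$w_k=\frac{\alpha_k^{-1}}{\sum_{j=1}^m\alpha_j^{-1}},\qquad \bar{\Delta}=\sum_{k=1}^m w_k\,\widehat{\Delta}^{(k)}.$$ Then, for every realization of the noise, $\sum_{k=1}^m w_k\,\epsilon_k=0$, and consequently $$\bar{\Delta}=\Delta^\star(\theta)+\sum_{k=1}^m w_k\,\rho_k .$$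
   Context: The parameter space is decomposed into $L$ blocks, $\mathbb{R}^d=\mathbb{R}^{d_1}\times\cdots\times\mathbb{R}^{d_L}$, with noise scales $\sigma_1,\dots,\sigma_L>0$. For each block $\ell$ one draws i.i.d. Gaussian vectors $z_{k,\ell}\sim\mathcal{N}(0,\sigma_\ell^2 I_{d_\ell})$, $k=1,\dots,m$, sets $\bar z_\ell=\frac1m\sum_{k=1}^m z_{k,\ell}$, and defines $\epsilon^{0}_{k,\ell}=\sqrt{\tfrac{m}{m-1}}\,(z_{k,\ell}-\bar z_\ell)\in\mathbb{R}^{d_\ell}$. The base noise vector of copy $k$ is the concatenation $\epsilon_k^{0}=(\epsilon^{0}_{k,1},\dots,\epsilon^{0}_{k,L})\in\mathbb{R}^d$, and the scaled noise vector is $\epsilon_k=\alpha_k\,\epsilon_k^{0}$. Here $\Delta^\star(\theta)$ is the noise-free displacement produced by an update routine started at parameters $\theta$, and $\widehat{\Delta}^{(k)}$ is the displacement obtained from the $k$-th perturbed copy. *)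

(* Defs.v *)
From HB Require Import structures.
From mathcomp Require Import all_boot all_order all_algebra.
From mathcomp Require Import all_classical all_reals all_analysis.

Set Implicit Arguments.
Unset Strict Implicit.
Unset Printing Implicit Defensive.

Import Order.TTheory GRing.Theory Num.Theory.
Import numFieldNormedType.Exports.

Local Open Scope classical_set_scope.
Local Open Scope ring_scope.

Definition borel_rV (R : realType) (n : nat) : set (set 'rV[R]_n) :=
  <<s [set U : set 'rV[R]_n | open U] >>.

Definition random_vector (d : measure_display) (T : measurableType d)
    (R : realType) (n : nat) (X : T -> 'rV[R]_n) : Prop :=
  forall B, borel_rV B -> measurable (X @^-1` B).

(* Mutual independence of a finite family of random elements of U, where G is
   the sigma-algebra considered on U. *)
Definition mutually_independent (d : measure_display) (T : measurableType d)
    (R : realType) (P : probability T R) (I : finType) (U : Type)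
    (G : set (set U)) (X : I -> T -> U) : Prop :=
  forall (J : {set I}) (B : I -> set U),
    (forall i, i \in J -> G (B i)) ->
    P (\bigcap_(i in [set` J]) (X i @^-1` B i)) =
    (\prod_(i in J) P (X i @^-1` B i))%E.

(* X ~ N(0, s^2 I_n), i.e. the law of X is the n-fold product of N(0, s^2).
   The second argument of normal_prob is the standard deviation. *)
Definition isotropic_gaussian (d : measure_display) (T : measurableType d)
    (R : realType) (P : probability T R) (n : nat) (s : R)
    (X : T -> 'rV[R]_n) : Prop :=
  [/\ random_vector X,
      forall (i : 'I_n) (A : set R), measurable A ->
        P ((fun t => X t 0 i) @^-1` A) = normal_prob 0 s A &
      mutually_independent P measurable (fun (i : 'I_n) t => X t 0 i)].

Definition iid_gaussian (d : measure_display) (T : measurableType d)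
    (R : realType) (P : probability T R) (m n : nat) (s : R)
    (X : 'I_m -> T -> 'rV[R]_n) : Prop :=
  (forall k, isotropic_gaussian P s (X k)) /\
  mutually_independent P (@borel_rV R n) X.

(* z k l is the (realized) draw z_{k,l}. *)
Definition block_mean (R : realType) (m L : nat) (dim : 'I_L -> nat)
    (z : 'I_m -> forall l : 'I_L, 'rV[R]_(dim l)) (l : 'I_L) : 'rV[R]_(dim l) :=
  m%:R^-1 *: \sum_(k < m) z k l.

Definition block_noise (R : realType) (m L : nat) (dim : 'I_L -> nat)
    (z : 'I_m -> forall l : 'I_L, 'rV[R]_(dim l)) (k : 'I_m) (l : 'I_L) :
    'rV[R]_(dim l) :=
  Num.sqrt (m%:R / (m%:R - 1)) *: (z k l - block_mean z l).

Definition base_noise (R : realType) (m L : nat) (dim : 'I_L -> nat)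
    (z : 'I_m -> forall l : 'I_L, 'rV[R]_(dim l)) (k : 'I_m) :
    'rV[R]_(\sum_(l < L) dim l) :=
  \mxrow_(l < L) block_noise z k l.

Definition scaled_noise (R : realType) (m L : nat) (dim : 'I_L -> nat)
    (alpha : 'I_m -> R) (z : 'I_m -> forall l : 'I_L, 'rV[R]_(dim l))
    (k : 'I_m) : 'rV[R]_(\sum_(l < L) dim l) :=
  alpha k *: base_noise z k.

Definition harmonic_weight (R : realType) (m : nat) (alpha : 'I_m -> R)
    (k : 'I_m) : R :=
  (alpha k)^-1 / \sum_(j < m) (alpha j)^-1.

Definition aggregate (R : realType) (m D : nat) (alpha : 'I_m -> R)
    (Dhat : 'I_m -> 'rV[R]_D) : 'rV[R]_D :=
  \sum_(k < m) harmonic_weight alpha k *: Dhat k.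

(* Vectors are rows and 'J f x acts on the right, so that v *m 'J f x is the
   differential of f at x applied to v: the product "J v" for the Jacobian
   matrix J acting on columns. *)
Definition jacobian_apply (R : realType) (D : nat) (f : 'rV[R]_D -> 'rV[R]_D)
    (x v : 'rV[R]_D) : 'rV[R]_D := v *m 'J f x.

(* Main.v *)
Require Import Defs.
From HB Require Import structures.
From mathcomp Require Import all_boot all_order all_algebra.
From mathcomp Require Import all_classical all_reals all_analysis.
Import Order.TTheory GRing.Theory Num.Theory.
Import numFieldNormedType.Exports.

Local Open Scope classical_set_scope.
Local Open Scope ring_scope.

(** Deviations from an empirical mean sum to zero, so the base noise sums to zero over the copies,
    block by block ([sum_base_noise]). The harmonic weight is proportional to the inverse of
    [alpha k], so each weighted noise vector is the base noise times a factor common to all copies,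
    and the weighted noises cancel ([sum_weighted_noise]). The Jacobian is linear and therefore
    kills the whole first-order term; as the weights sum to 1, [Dstar theta] survives intact and
    only the averaged remainders are added to it. *)

Lemma sum_block_noise (R : realType) (m L : nat) (dim : 'I_L -> nat)
    (z : 'I_m -> forall l : 'I_L, 'rV[R]_(dim l)) (l : 'I_L) :
  (0 < m)%N -> \sum_(k < m) block_noise z k l = 0.
Proof.
move=> m_gt0; rewrite -scaler_sumr sumrB sumr_const card_ord /block_mean.
(* The mean is subtracted [m] times, and [m] times the mean is the full sum because [m] is
   nonzero. *)
rewrite -[(_ *: _) *+ _]scaler_nat scalerA divff ?scale1r ?subrr ?scaler0 //.
by rewrite pnatr_eq0 -lt0n.
Qed.

Lemma sum_base_noise (R : realType) (m L : nat) (dim : 'I_L -> nat)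
    (z : 'I_m -> forall l : 'I_L, 'rV[R]_(dim l)) :
  (0 < m)%N -> \sum_(k < m) base_noise z k = 0.
Proof.
(* Summing over copies commutes with concatenating blocks, which reduces the claim to a single
   block. *)
move=> m_gt0; rewrite /base_noise -mxrow_sum -[RHS]mxrow0.
by apply: eq_mxrow => l; rewrite sum_block_noise.
Qed.

Lemma sum_harmonic_weight (R : realType) (m : nat) (alpha : 'I_m -> R) :
  (0 < m)%N -> (forall k, 0 < alpha k) ->
  \sum_(k < m) harmonic_weight alpha k = 1.
Proof.
move=> m_gt0 alpha_gt0; rewrite -mulr_suml divff //.
(* The normalizer is nonzero: one term, available since [0 < m], is strictly positive and the others
   are nonnegative. *)
rewrite lt0r_neq0 // (bigD1 (Ordinal m_gt0)) //=.
rewrite ltr_pwDl ?invr_gt0 // sumr_ge0 // => k _.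
by rewrite invr_ge0 ltW.
Qed.

(* The weight [w k] cancels the scale [alpha k], leaving a multiple of the
   zero-sum base noise. *)
Lemma sum_weighted_noise (R : realType) (m L : nat) (dim : 'I_L -> nat)
    (alpha : 'I_m -> R) (z : 'I_m -> forall l : 'I_L, 'rV[R]_(dim l)) :
  (0 < m)%N -> (forall k, alpha k != 0) ->
  \sum_(k < m) harmonic_weight alpha k *: scaled_noise alpha z k = 0.
Proof.
move=> m_gt0 alpha_neq0.
transitivity ((\sum_(j < m) (alpha j)^-1)^-1 *: \sum_(k < m) base_noise z k).
  rewrite scaler_sumr; apply: eq_bigr => k _.
  by rewrite scalerA /harmonic_weight mulrAC mulVf ?mul1r.
by rewrite sum_base_noise ?scaler0.
Qed.

Theorem mainTheorem1
    (R : realType)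
    (disp : measure_display) (T : measurableType disp) (P : probability T R)
    (m L : nat) (dim : 'I_L -> nat)
    (sigma : 'I_L -> R) (alpha : 'I_m -> R)
    (Z : 'I_m -> forall l : 'I_L, T -> 'rV[R]_(dim l))
    (m_ge2 : (2 <= m)%N)
    (sigma_gt0 : forall l, 0 < sigma l)
    (alpha_gt0 : forall k, 0 < alpha k)
    (Z_iid : forall l, iid_gaussian P (sigma l) (fun k => Z k l))
    (theta : 'rV[R]_(\sum_(l < L) dim l))
    (Dstar : 'rV[R]_(\sum_(l < L) dim l) -> 'rV[R]_(\sum_(l < L) dim l))
    (Dstar_diff : differentiable Dstar theta)
    (omega : T) :
  let eps := scaled_noise alpha (fun k l => Z k l omega) in
  let w := harmonic_weight alpha in
  forall (Dhat rho : 'I_m -> 'rV[R]_(\sum_(l < L) dim l)),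
  (forall k, Dhat k = Dstar theta + jacobian_apply Dstar theta (eps k) + rho k) ->
  \sum_(k < m) w k *: eps k = 0 /\
  aggregate alpha Dhat = Dstar theta + \sum_(k < m) w k *: rho k.
Proof.
move=> eps w Dhat rho Dhat_eq.
have m_gt0 : (0 < m)%N by apply: ltnW.
have w_eps0 : \sum_(k < m) w k *: eps k = 0.
  by apply: sum_weighted_noise => // k; rewrite lt0r_neq0.
split=> //; rewrite /aggregate.
(* Moving the weight inside the product with the Jacobian lets the first-order terms factor as the
   weighted noise sum times one fixed matrix. *)
transitivity (\sum_(k < m) (w k *: Dstar theta +
    (w k *: eps k) *m 'J Dstar theta + w k *: rho k)).
  by apply: eq_bigr => k _; rewrite Dhat_eq !scalerDr scalemxAl.
rewrite !big_split /= -scaler_suml sum_harmonic_weight // scale1r.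
by rewrite -mulmx_suml w_eps0 mul0mx addr0.
Qed.
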